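(* Let $k$ be an algebraically closed field, $A=kQ$ the path algebra of a finite quiver $Q$, $T$ a finite-dimensional left $A$-module with dimension vector $t=\underline{\dim}\,T$, $A[T]$ the one-point extension of $A$ by $T$, and $(s,d)\in\mathbb N\times\mathbb N^{Q_0}$. Assume $\gamma_{T^s,d}=d$ and $\mathrm{Ext}^1_A(T,T)=0$. Then $\mathrm{Rep}^{\mathrm{full}}_{(s,d)}(A[T])$ is irreducible and smooth of dimension \[ \dim\mathrm{Rep}^{\mathrm{full}}_{(s,d)}(A[T])=\dim\mathrm{Rep}_d(Q)+s\cdot\langle t,d\rangle_Q . \]
   Context: $A[T]$ is the $k$-algebra of formal matrices $\begin{pmatrix} a & t\\ 0&\lambda\end{pmatrix}$ with $a\in A$, $t\in T$, $\lambda\in k$, with componentwise addition and formal matrix multiplication. Left $A[T]$-modules are identified with triples $(M,V,f)$, $M$ a left $A$-module, $V$ a $k$-vector space, $f:T\otimes_kV\to M$ $A$-linear; the dimension vector is $(\dim V,\underline{\dim}\,M)$. $A[T]\cong k\hat Q/(\mathrm{Rel})$, where $\hat Q$ is obtained from $Q$ by adding a vertex $\infty$ and arrows $\rho_{l,(i)}:\infty\to i$ for $i\in Q_0$, $l=1,\dots,\dim T_i$ (corresponding to a basis of $T_i$), with relations $\alpha\rho_{l,(i)}=\sum_{m}\lambda^{(\alpha)}_{m,l}\rho_{m,(j)}$ for each arrow $\alpha:i\to j$ of $Q$, where $T(\alpha)\rho_{l,(i)}=\sum_m\lambda^{(\alpha)}_{m,l}\rho_{m,(j)}$. $\mathrm{Rep}_d(Q)=\prod_{(\alpha:i\to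 j)\in Q_1}\mathrm{Hom}_k(k^{d_i},k^{d_j})$, and $\mathrm{Rep}_{(s,d)}(A[T])\subseteq\mathrm{Rep}_{(s,d)}(\hat Q)$ is the closed subvariety (scheme) cut out by the relations; its points are pairs $(f,M)$ with $M\in\mathrm{Rep}_d(Q)$, $f\in\mathrm{Hom}_A(T^s,M)$. The rank of a morphism $f$ of $Q$-representations is the dimension vector of its image. The general rank $\gamma_{T^s,d}\in\mathbb N^{Q_0}$ is the rank of a general homomorphism from $T^s$ to a general representation of dimension vector $d$ (i.e. for $M$ in a dense open subset of $\mathrm{Rep}_d(Q)$ the maximal rank of morphisms $T^s\to M$, attained on a dense open subset of $\mathrm{Hom}_A(T^s,M)$, is $\gamma_{T^s,d}$). $\mathrm{Rep}^{\mathrm{full}}_{(s,d)}(A[T])=\{(f,M):\mathrm{rank} f=\gamma_{T^s,d}\}$, an open subset of $\mathrm{Rep}_{(s,d)}(A[T])$; when $\gamma_{T^s,d}=d$ this is the locus where $f$ is surjective. $\langle d,e\rangle_Q=\sum_{i\in Q_0}d_ie_i-\sum_{(\alpha:i\to j)\in Q_1}d_ie_j$. *)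

(* Defs.v *)
From HB Require Import structures.
From mathcomp Require Import all_boot all_order all_algebra.
From mathcomp Require Import mpoly.

Set Implicit Arguments.
Unset Strict Implicit.
Unset Printing Implicit Defensive.

Import GRing.Theory.
Local Open Scope ring_scope.

(* Zariski geometry in the affine space k^n, whose points are row vectors.
   A subset of k^n always carries the induced topology.  Over an algebraically
   closed field the lattice of closed subsets of a k-scheme of finite type is
   the lattice of closed subsets of its set of k-points, so irreducibility and
   (local) dimension may be read off on k-points. *)

Definition aset (k : fieldType) (n : nat) := 'rV[k]_n -> Prop.

Definition asetT (k : fieldType) (n : nat) : aset k n := fun _ => True.

Definition asubset (k : fieldType) (n : nat) (X Y : aset k n) :=
  forall x, X x -> Y x.

(* A set of equations is viewed as the closed subscheme of k^n defined by the
   ideal it generates, which need not be radical. *)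
Definition equations (k : fieldType) (n : nat) := {mpoly k[n]} -> Prop.

Definition zeros (k : fieldType) (n : nat) (E : equations k n) : aset k n :=
  fun x => forall p, E p -> p.@[x 0] = 0.

Definition closed_in (k : fieldType) (n : nat) (X Z : aset k n) :=
  exists E : equations k n, forall x, Z x <-> X x /\ zeros E x.

Definition open_in (k : fieldType) (n : nat) (X U : aset k n) :=
  exists E : equations k n, forall x, U x <-> X x /\ ~ zeros E x.

Definition dense_in (k : fieldType) (n : nat) (X U : aset k n) :=
  asubset U X /\ forall Z, closed_in X Z -> asubset U Z -> asubset X Z.

Definition irreducible (k : fieldType) (n : nat) (X : aset k n) :=
  (exists x, X x) /\
  forall Z1 Z2, closed_in X Z1 -> closed_in X Z2 ->
    (forall x, X x -> Z1 x \/ Z2 x) -> asubset X Z1 \/ asubset X Z2.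

(* Z 0 < Z 1 < ... < Z r; the values Z i for i > r are irrelevant. *)
Definition irreducible_chain (k : fieldType) (n : nat) (X : aset k n)
    (r : nat) (Z : nat -> aset k n) :=
  (forall i, (i <= r)%N -> closed_in X (Z i) /\ irreducible (Z i)) /\
  (forall i, (i < r)%N ->
     asubset (Z i) (Z i.+1) /\ ~ asubset (Z i.+1) (Z i)).

(* The Krull dimension of the topological space X is r. *)
Definition has_dim (k : fieldType) (n : nat) (X : aset k n) (r : nat) :=
  (exists Z, irreducible_chain X r Z) /\
  (forall m Z, irreducible_chain X m Z -> (m <= r)%N).

(* Prime ideals of the local ring of a scheme at x correspond to irreducible
   closed subsets through x, so for X = zeros E this says that the Krull
   dimension of the local ring at x is r. *)
Definition has_dim_at (k : fieldType) (n : nat) (X : aset k n) (x : 'rV[k]_n)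
    (r : nat) :=
  (exists Z, irreducible_chain X r Z /\ Z 0%N x) /\
  (forall m Z, irreducible_chain X m Z -> Z 0%N x -> (m <= r)%N).

(* Zariski tangent space at x of the scheme defined by E (kernel of the
   Jacobian matrix), the dual of the fibre at x of its sheaf of differentials. *)
Definition tangent (k : fieldType) (n : nat) (E : equations k n)
    (x v : 'rV[k]_n) :=
  forall p, E p -> \sum_(j < n) (mderiv j p).@[x 0] * v 0 j = 0.

Definition has_tangent_dim (k : fieldType) (n : nat) (E : equations k n)
    (x : 'rV[k]_n) (r : nat) :=
  exists V : {vspace 'rV[k]_n},
    (forall v, v \in V <-> tangent E x v) /\ \dim V = r.

Definition smooth_at (k : fieldType) (n : nat) (E : equations k n)
    (x : 'rV[k]_n) :=
  exists r, has_dim_at (zeros E) x r /\ has_tangent_dim E x r.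

(* Smoothness of the open subscheme, with underlying set U, of the scheme
   defined by E; testing at k-points suffices since k is algebraically closed. *)
Definition smooth_on (k : fieldType) (n : nat) (E : equations k n)
    (U : aset k n) :=
  forall x, U x -> smooth_at E x.

(* Families of matrices, and their identification with an affine space. *)

Definition mxfam (R : Type) (J : finType) (m n : J -> nat) :=
  forall j : J, 'M[R]_(m j, n j).

Definition coord (J : finType) (m n : J -> nat) : finType :=
  {j : J & ('I_(m j) * 'I_(n j))%type}.

Definition fam_of_fun (R : Type) (J : finType) (m n : J -> nat)
    (c : 'I_#|coord m n| -> R) : mxfam R m n :=
  fun j => \matrix_(p, q)
    c (enum_rank (Tagged (fun i => ('I_(m i) * 'I_(n i))%type) (p, q))).

(* Quiver representations, acting on column vectors. *)

Record quiver := Quiver {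
  vert : finType;
  arr : finType;
  src : arr -> vert;
  tgt : arr -> vert }.

Definition rep (R : Type) (Q : quiver) (d : vert Q -> nat) :=
  mxfam R (fun a : arr Q => d (tgt a)) (fun a : arr Q => d (src a)).

Definition rep_coord (Q : quiver) (d : vert Q -> nat) : finType :=
  coord (fun a : arr Q => d (tgt a)) (fun a : arr Q => d (src a)).

Definition rep_point (R : Type) (Q : quiver) (d : vert Q -> nat)
    (x : 'rV[R]_#|rep_coord d|) : rep R d :=
  fam_of_fun (x ord0).

Definition vmap (R : Type) (Q : quiver) (d e : vert Q -> nat) :=
  mxfam R e d.

Definition vmap_coord (Q : quiver) (d e : vert Q -> nat) : finType :=
  coord e d.

Definition vmap_point (R : Type) (Q : quiver) (d e : vert Q -> nat)
    (x : 'rV[R]_#|vmap_coord d e|) : vmap R d e :=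
  fam_of_fun (x ord0).

Definition is_hom (R : nzRingType) (Q : quiver) (d e : vert Q -> nat)
    (M : rep R d) (N : rep R e) (f : vmap R d e) :=
  forall a : arr Q, f (tgt a) *m M a = N a *m f (src a).

Definition short_exact (R : nzRingType) (Q : quiver) (d e c : vert Q -> nat)
    (N : rep R d) (E : rep R e) (M : rep R c)
    (f : vmap R d e) (g : vmap R e c) :=
  [/\ is_hom N E f,
      is_hom E M g,
      forall i (u : 'cV[R]_(d i)), f i *m u = 0 -> u = 0,
      forall i (v : 'cV[R]_(e i)),
        g i *m v = 0 <-> exists u : 'cV[R]_(d i), v = f i *m u &
      forall i (w : 'cV[R]_(c i)), exists v : 'cV[R]_(e i), g i *m v = w].

(* Ext^1(M, N) = 0 in Yoneda's sense: each extension of M by N splits.  The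
   middle term of such an extension is automatically finite-dimensional. *)
Definition ext1_eq0 (R : nzRingType) (Q : quiver) (c d : vert Q -> nat)
    (M : rep R c) (N : rep R d) :=
  forall (e : vert Q -> nat) (E : rep R e) (f : vmap R d e) (g : vmap R e c),
    short_exact N E M f g ->
    exists h : vmap R c e, is_hom M E h /\ forall i, g i *m h i = 1%:M.

Definition euler_form (Q : quiver) (d e : vert Q -> nat) : int :=
  \sum_(i : vert Q) (d i * e i)%:Z -
  \sum_(a : arr Q) (d (src a) * e (tgt a))%:Z.

Definition pow_dim (Q : quiver) (s : nat) (t : vert Q -> nat) :
    vert Q -> nat :=
  fun i => (\sum_(l < s) t i)%N.

Definition rep_pow (R : nzRingType) (Q : quiver) (t : vert Q -> nat)
    (T : rep R t) (s : nat) : rep R (pow_dim s t) :=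
  fun a => \mxblock_(p < s, q < s) (if p == q then T a else 0).

Definition has_rank (k : fieldType) (Q : quiver) (d e : vert Q -> nat)
    (f : vmap k d e) (r : vert Q -> nat) :=
  forall i, \rank (f i) = r i.

Definition hom_set (k : fieldType) (Q : quiver) (d e : vert Q -> nat)
    (M : rep k d) (N : rep k e) : aset k #|vmap_coord d e| :=
  fun f => is_hom M N (vmap_point f).

(* gamma is the general rank of homomorphisms from T^s to representations of
   dimension vector d. *)
Definition is_general_rank (k : fieldType) (Q : quiver) (t : vert Q -> nat)
    (T : rep k t) (s : nat) (d gamma : vert Q -> nat) :=
  exists U : aset k #|rep_coord d|,
    [/\ open_in (@asetT _ _) U,
        dense_in (@asetT _ _) U &
        forall M, U M ->
          let H := hom_set (rep_pow T s) (rep_point M) in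
          (forall f, H f -> forall i, (\rank (vmap_point f i) <= gamma i)%N) /\
          exists W, [/\ open_in H W, dense_in H W &
            forall f, W f -> has_rank (vmap_point f) gamma]].

(* One-point extension.  The new vertex is None and the new arrows
   rho_{l,(i)} : None -> Some i are indexed by the pairs (i, l), l < t i. *)

Definition rho_index (Q : quiver) (t : vert Q -> nat) : finType :=
  {i : vert Q & 'I_(t i)}.

Definition ext_quiver (Q : quiver) (t : vert Q -> nat) : quiver :=
  @Quiver (option (vert Q)) (arr Q + rho_index t)%type
    (fun a => match a with inl b => Some (src b) | inr _ => None end)
    (fun a => match a with inl b => Some (tgt b) | inr r => Some (tag r) end).

Definition ext_dim (Q : quiver) (t : vert Q -> nat) (s : nat)
    (d : vert Q -> nat) : vert (ext_quiver t) -> nat :=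
  fun v => if v is Some i then d i else s.

Section OnePointExtension.

Variables (R : nzRingType) (Q : quiver) (t : vert Q -> nat) (s : nat).
Variable d : vert Q -> nat.
Variable X : rep R (ext_dim (t := t) s d).

Definition base_part : rep R d := fun a => X (inl a).

Definition rho (i : vert Q) (l : 'I_(t i)) : 'M[R]_(d i, s) :=
  X (inr (Tagged (fun i => 'I_(t i)) l)).

(* alpha rho_{l,(i)} - sum_m lambda_{m,l} rho_{m,(j)} for alpha : i -> j,
   where lambda is the matrix of T(alpha). *)
Definition relator (T : rep R t) (a : arr Q) (l : 'I_(t (src a))) :
    'M[R]_(d (tgt a), s) :=
  base_part a *m rho l - \sum_(m < t (tgt a)) T a m l *: rho m.

(* The map f : T^s -> M sending the l-th basis vector of the c-th copy of T_i
   to the image under rho_{l,(i)} of the c-th basis vector of k^s. *)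
Definition hom_part : vmap R (pow_dim s t) d :=
  fun i => \mxrow_(c < s) \matrix_(r < d i, l < t i) rho l r c.

End OnePointExtension.

Section RepScheme.

Variables (k : fieldType) (Q : quiver) (t : vert Q -> nat) (T : rep k t).
Variables (s : nat) (d : vert Q -> nat).

(* Ambient affine space Rep_{(s,d)} of the extended quiver. *)
Local Notation N := #|rep_coord (ext_dim (t := t) s d)|.

Definition generic_rep : rep {mpoly k[N]} (ext_dim (t := t) s d) :=
  fam_of_fun (fun j => 'X_j).

Definition one_point_eqs : equations k N :=
  fun p => exists (a : arr Q) (l : 'I_(t (src a))) (r : 'I_(d (tgt a)))
    (c : 'I_s),
    p = relator generic_rep (fun b => map_mx (fun z => z%:MP) (T b)) l r c.

Definition rep_full (gamma : vert Q -> nat) : aset k N :=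
  fun x => zeros one_point_eqs x /\ has_rank (hom_part (rep_point x)) gamma.

End RepScheme.

Arguments one_point_eqs {k Q t} T s d.
Arguments rep_full {k Q t} T s d gamma.

(* Main.v *)
Require Import Defs.
From HB Require Import structures.
From mathcomp Require Import all_boot all_order all_algebra.
From mathcomp Require Import mpoly zify.
From Stdlib Require Import Classical_Prop.
Import GRing.Theory.
Local Open Scope ring_scope.

Set Implicit Arguments.
Unset Strict Implicit.
Unset Printing Implicit Defensive.

(** A point of the representation space is a representation [M] together with
    maps [f], one family [T -> M] for each basis vector at the new vertex, and
    the equations say that these are homomorphisms. For fixed [M] they are
    linear in [f]: the system is [s] copies of the coboundary map
    [h |-> M h - h T], whose cokernel is [Ext^1(T, M)].

    If [f : T^s -> M] is surjective, every cocycle with values in [M] lifts to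
    a cocycle with values in [T^s], which is a coboundary since
    [Ext^1(T, T) = 0]; so the cokernel vanishes and the system has full rank [r],
    the number of equations ([quotient_coboundary], [full_rank_one_point]).
    Surjectivity is an open condition, and it is satisfied somewhere because
    [d] is the general rank. Hence the locus in question is a nonempty open
    subset of the zero locus of the equations, contained in the part of it that
    is a vector bundle, of kernels of a system of constant rank, over an open
    subset of the affine space of all [M].

    The rest is about such kernel bundles in affine [N]-space.
    - Irreducibility ([kernel_bundle_irreducible]): two nonempty open sets have
      points over a common [M], since the base is open in an affine space; the
      line through these points lies in the fibre, and both sets are cofinite
      on it.
    - Dimension ([kernel_chart], [chart_has_dim_at]): a right inverse of the
      system at one point gives a polynomial parametrization by [N - r]
      parameters near that point. Chains of irreducible closed sets of length
      [N - r] come from a flag of affine subspaces of the parameter space.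
      Longer ones do not exist: a chain of length [m] provides [m] functions
      whose monomials are linearly independent ([chain_free]), while in [n]
      variables the number of independent polynomials of degree at most [D]
      grows like [D ^ n].
    - Smoothness ([kernel_bundle_tangent]): the part of the Jacobian matrix that
      belongs to the coordinates of [f] is the matrix of the system, which has
      rank [r].

    Finally [N - r] is computed by counting coordinates and equations. *)

(** * Polynomial functions *)

Section PolyFun.

Variable k : fieldType.

Definition polyfun n (F : 'rV[k]_n -> k) :=
  exists p : {mpoly k[n]}, forall y, F y = p.@[y 0].

Definition polymx n a b (F : 'rV[k]_n -> 'M[k]_(a, b)) :=
  forall i j, polyfun (fun y => F y i j).

Lemma eq_polyfun n (F G : 'rV[k]_n -> k) : F =1 G -> polyfun F -> polyfun G.
Proof. by move=> FG [p hp]; exists p => y; rewrite -FG. Qed.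

Lemma polyfun_meval n (p : {mpoly k[n]}) : polyfun (fun y => p.@[y 0]).
Proof. by exists p. Qed.

Lemma polyfun_const n c : polyfun (fun _ : 'rV[k]_n => c).
Proof. by exists c%:MP => y; rewrite mevalC. Qed.

Lemma polyfun_coord n j : polyfun (fun y : 'rV[k]_n => y 0 j).
Proof. by exists 'X_j => y; rewrite mevalXU. Qed.

Lemma polyfunD n (F G : 'rV[k]_n -> k) :
  polyfun F -> polyfun G -> polyfun (fun y => F y + G y).
Proof. by move=> [p hp] [q hq]; exists (p + q) => y; rewrite mevalD hp hq. Qed.

Lemma polyfunM n (F G : 'rV[k]_n -> k) :
  polyfun F -> polyfun G -> polyfun (fun y => F y * G y).
Proof. by move=> [p hp] [q hq]; exists (p * q) => y; rewrite mevalM hp hq. Qed.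

Lemma polyfunN n (F : 'rV[k]_n -> k) : polyfun F -> polyfun (fun y => - F y).
Proof. by move=> [p hp]; exists (- p) => y; rewrite mevalN hp. Qed.

Lemma polyfun_sum n (I : finType) (P : pred I) (F : I -> 'rV[k]_n -> k) :
  (forall i, P i -> polyfun (F i)) -> polyfun (fun y => \sum_(i | P i) F i y).
Proof.
move=> hF; have {hF} [p hp] : exists p : I -> {mpoly k[n]},
    forall i, P i -> forall y, F i y = (p i).@[y 0].
  apply: (fin_all_exists (P := fun i p => P i -> forall y, F i y = p.@[y 0])) => i.
  by case: (boolP (P i)) => [/hF [p hp]|_]; [exists p | exists 0].
exists (\sum_(i | P i) p i) => y; rewrite raddf_sum /=.
by apply: eq_bigr => i Pi; rewrite hp.
Qed.

Lemma polyfun_prod n (I : finType) (P : pred I) (F : I -> 'rV[k]_n -> k) :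
  (forall i, P i -> polyfun (F i)) -> polyfun (fun y => \prod_(i | P i) F i y).
Proof.
move=> hF; have {hF} [p hp] : exists p : I -> {mpoly k[n]},
    forall i, P i -> forall y, F i y = (p i).@[y 0].
  apply: (fin_all_exists (P := fun i p => P i -> forall y, F i y = p.@[y 0])) => i.
  by case: (boolP (P i)) => [/hF [p hp]|_]; [exists p | exists 0].
exists (\prod_(i | P i) p i) => y; rewrite rmorph_prod /=.
by apply: eq_bigr => i Pi; rewrite hp.
Qed.

Lemma polymx_tuple n N (G : 'rV[k]_n -> 'rV[k]_N) : polymx G ->
  exists lq : N.-tuple {mpoly k[n]},
    forall g (y : 'rV[k]_n), (g \mPo lq).@[y 0] = g.@[G y 0].
Proof.
move=> hG; have [p hp] : exists p : 'I_N -> {mpoly k[n]},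
    forall j (y : 'rV[k]_n), G y 0 j = (p j).@[y 0].
  exact: (fin_all_exists (P := fun j p => forall y : 'rV[k]_n, G y 0 j = p.@[y 0]) (hG 0)).
exists [tuple p j | j < N] => g y; rewrite comp_mpoly_meval.
by apply: meval_eq => j; rewrite tnth_mktuple hp.
Qed.

Lemma polyfun_comp n N (F : 'rV[k]_N -> k) (G : 'rV[k]_n -> 'rV[k]_N) :
  polyfun F -> polymx G -> polyfun (fun y => F (G y)).
Proof.
move=> [p hp] /polymx_tuple [lq hlq].
by exists (p \mPo lq) => y; rewrite hlq hp.
Qed.

Lemma polymx_comp n N a b (F : 'rV[k]_N -> 'M[k]_(a, b))
    (G : 'rV[k]_n -> 'rV[k]_N) :
  polymx F -> polymx G -> polymx (fun y => F (G y)).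
Proof. by move=> hF hG i j; apply: (polyfun_comp (hF i j) hG). Qed.

Lemma polymx_const n a b (A : 'M[k]_(a, b)) : polymx (fun _ : 'rV[k]_n => A).
Proof. by move=> i j; apply: polyfun_const. Qed.

Lemma polymx_id n : polymx (fun y : 'rV[k]_n => y).
Proof. by move=> i j; rewrite ord1; apply: polyfun_coord. Qed.

Lemma polymxD n a b (F G : 'rV[k]_n -> 'M[k]_(a, b)) :
  polymx F -> polymx G -> polymx (fun y => F y + G y).
Proof.
move=> hF hG i j; apply: eq_polyfun (polyfunD (hF i j) (hG i j)) => y.
by rewrite mxE.
Qed.

Lemma polymxN n a b (F : 'rV[k]_n -> 'M[k]_(a, b)) :
  polymx F -> polymx (fun y => - F y).
Proof. by move=> hF i j; apply: eq_polyfun (polyfunN (hF i j)) => y; rewrite mxE. Qed.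

Lemma polymxZ n a b (c : 'rV[k]_n -> k) (F : 'rV[k]_n -> 'M[k]_(a, b)) :
  polyfun c -> polymx F -> polymx (fun y => c y *: F y).
Proof.
by move=> hc hF i j; apply: eq_polyfun (polyfunM hc (hF i j)) => y; rewrite mxE.
Qed.

Lemma polymxM n a b c (F : 'rV[k]_n -> 'M[k]_(a, b))
    (G : 'rV[k]_n -> 'M[k]_(b, c)) :
  polymx F -> polymx G -> polymx (fun y => F y *m G y).
Proof.
move=> hF hG i j.
apply: (@eq_polyfun _ (fun y => \sum_l F y i l * G y l j)) => [y|].
  by rewrite mxE.
by apply: polyfun_sum => l _; apply: polyfunM.
Qed.

Lemma polyfun_det n a (F : 'rV[k]_n -> 'M[k]_a) :
  polymx F -> polyfun (fun y => \det (F y)).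
Proof.
move=> hF; rewrite /determinant; apply: polyfun_sum => s _.
by apply: polyfunM; [apply: polyfun_const | apply: polyfun_prod].
Qed.

Lemma polymx_adj n a (F : 'rV[k]_n -> 'M[k]_a) :
  polymx F -> polymx (fun y => \adj (F y)).
Proof.
move=> hF i j; apply: (@eq_polyfun _ (fun y => cofactor (F y) j i)) => [y|].
  by rewrite mxE.
rewrite /cofactor; apply: polyfunM; first exact: polyfun_const.
apply: polyfun_det => u v.
by apply: eq_polyfun (hF (lift j u) (lift i v)) => y; rewrite !mxE.
Qed.

End PolyFun.

Lemma base_expansion_inj W n (a b : 'I_n -> nat) :
  (forall i, a i < W)%N -> (forall i, b i < W)%N ->
  (\sum_(i < n) a i * W ^ i = \sum_(i < n) b i * W ^ i)%N -> a =1 b.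
Proof.
elim: n a b => [|n IH] a b ha hb; first by move=> _ [].
have W0 : (0 < W)%N by apply: leq_ltn_trans (ha ord0).
have shift (c : 'I_n.+1 -> nat) : (\sum_(i < n.+1) c i * W ^ i =
    (\sum_(i < n) c (lift ord0 i) * W ^ i) * W + c ord0)%N.
  rewrite big_ord_recl /= expn0 muln1 addnC; congr (_ + _)%N.
  by rewrite big_distrl /=; apply: eq_bigr => i _; rewrite expnSr mulnA.
rewrite !shift => E.
have E0 : a ord0 = b ord0.
  by have := congr1 (modn^~ W) E; rewrite !modnMDl !modn_small.
have E1 : (\sum_(i < n) a (lift ord0 i) * W ^ i =
           \sum_(i < n) b (lift ord0 i) * W ^ i)%N.
  by have := congr1 (divn^~ W) E; rewrite !divnMDl ?divn_small ?addn0.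
move=> i; case: (unliftP ord0 i) => [j|] -> //.
exact: (IH _ _ (fun j => ha _) (fun j => hb _) E1).
Qed.

Section ClosedField.

Variable k : closedFieldType.

(** Kronecker's substitution of [t ^ (W ^ i)] for the [i]-th variable keeps the
    monomials of [p] apart as soon as [W] exceeds their degrees, so it turns a
    nonzero [p] into a nonzero polynomial in one variable. *)
Lemma mpoly_neq0_meval n (p : {mpoly k[n]}) :
  p != 0 -> exists y : 'rV[k]_n, p.@[y 0] != 0.
Proof.
move=> p0; pose W := msize p.
pose e (m : 'X_{1..n}) := (\sum_(i < n) m i * W ^ i)%N.
pose q : {poly k} := \sum_(m <- msupp p) p@_m *: 'X^(e m).
have supp_lt m i : m \in msupp p -> (m i < W)%N.
  move=> /msize_mdeg_lt; apply: leq_ltn_trans.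
  by rewrite mdegE (bigD1 i) //= leq_addr.
have q0 : q != 0.
  move: (p0); rewrite -msupp_eq0; case Es : (msupp p) => [//|m0 s] _.
  have m0p : m0 \in msupp p by rewrite Es mem_head.
  have : q`_(e m0) = p@_m0.
    rewrite coef_sum (bigD1_seq m0) ?msupp_uniq //= coefZ coefXn eqxx mulr1.
    rewrite big_seq_cond big1 ?addr0 // => m /andP[mp mm0].
    rewrite coefZ coefXn; case: eqP => [E|]; last by rewrite mulr0.
    case/eqP: mm0; apply/mnmP.
    by apply: (@base_expansion_inj W) => // i; apply: supp_lt.
  by apply: contra_eq_neq => ->; rewrite coef0 eq_sym -mcoeff_msupp.
have [t] := closed_nonrootP q q0; rewrite /root => qt.
exists (\row_i t ^+ (W ^ i)); apply: contra_neq qt => pt.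
rewrite -[RHS]pt horner_sum mevalE; apply: eq_bigr => m _.
rewrite hornerZ hornerXn; congr (_ * _).
by rewrite expr_sum; apply: eq_bigr => i _; rewrite mxE -exprM mulnC.
Qed.

End ClosedField.

(** Affine space is irreducible. *)
Lemma polyfun_domain (k : closedFieldType) n (F G : 'rV[k]_n -> k) :
  polyfun F -> polyfun G -> (forall y, F y * G y = 0) ->
  (forall y, F y = 0) \/ (forall y, G y = 0).
Proof.
move=> [p hp] [q hq] FG; have [p0|pn0] := eqVneq p 0.
  by left=> y; rewrite hp p0 meval0.
have [q0|qn0] := eqVneq q 0; first by right=> y; rewrite hq q0 meval0.
have /mpoly_neq0_meval[y] : p * q != 0 by rewrite mulf_neq0.
by rewrite mevalM -hp -hq FG eqxx.
Qed.

Lemma polyfun_common_nonzero (k : closedFieldType) n (F G : 'rV[k]_n -> k) a b :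
  polyfun F -> polyfun G -> F a != 0 -> G b != 0 ->
  exists2 y, F y != 0 & G y != 0.
Proof.
move=> pF' pG Fa Gb; apply: NNPP => H.
have [y|h|h] := polyfun_domain pF' pG.
- have [//|Fy] := eqVneq (F y) 0; first by move=> ->; rewrite mul0r.
  have [->|Gy] := eqVneq (G y) 0; first by rewrite mulr0.
  by case: H; exists y.
- by rewrite h eqxx in Fa.
- by rewrite h eqxx in Gb.
Qed.

(** * Irreducible sets and chains *)

Section Zariski.

Variable k : fieldType.

Definition vanishes n (X : aset k n) (p : {mpoly k[n]}) :=
  forall x, X x -> p.@[x 0] = 0.

Lemma not_vanishes n (X : aset k n) p :
  ~ vanishes X p -> exists2 x, X x & p.@[x 0] != 0.
Proof.
move=> H; apply: NNPP => H'; apply: H => x Xx.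
by apply/eqP; case: eqP => // /eqP px; case: H'; exists x.
Qed.

Lemma not_asubset n (X Y : aset k n) :
  ~ asubset X Y -> exists2 x, X x & ~ Y x.
Proof.
by move=> H; apply: NNPP => H'; apply: H => x Xx; apply: NNPP => Yx; case: H'; exists x.
Qed.

Lemma not_zeros n (E : equations k n) x :
  ~ zeros E x -> exists2 p, E p & p.@[x 0] != 0.
Proof.
move=> H; apply: NNPP => H'; apply: H => p Ep.
by apply/eqP; case: eqP => // /eqP px; case: H'; exists p.
Qed.

Lemma irreducible_prime n (X : aset k n) p q :
  irreducible X -> vanishes X (p * q) -> vanishes X p \/ vanishes X q.
Proof.
move=> [_ H] pq.
pose Z (r : {mpoly k[n]}) x := X x /\ r.@[x 0] = 0.
have clZ r : closed_in X (Z r).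
  exists (fun s => s = r) => x; split=> [[Xx rx]|[Xx h]]; split=> //.
    by move=> s ->.
  exact: h.
have [x Xx|h|h] := H _ _ (clZ p) (clZ q).
- have /eqP := pq _ Xx; rewrite mevalM mulf_eq0.
  by case/orP => /eqP h; [left | right].
- by left=> x /h [].
- by right=> x /h [].
Qed.

Lemma prime_irreducible n (X : aset k n) : (exists x, X x) ->
  (forall p q, vanishes X (p * q) -> vanishes X p \/ vanishes X q) ->
  irreducible X.
Proof.
move=> X0 H; split=> // Z1 Z2 [E1 h1] [E2 h2] cov.
apply: NNPP => /not_or_and[/not_asubset[x1 Xx1 Zx1] /not_asubset[x2 Xx2 Zx2]].
have /not_zeros[p E1p px1] : ~ zeros E1 x1 by move=> h; apply: Zx1; apply/h1.
have /not_zeros[q E2q qx2] : ~ zeros E2 x2 by move=> h; apply: Zx2; apply/h2.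
have [x Xx|h|h] := H p q.
- rewrite mevalM; have [/h1[_ /(_ _ E1p)->]|/h2[_ /(_ _ E2q)->]] := cov _ Xx.
    by rewrite mul0r.
  by rewrite mulr0.
- by rewrite h ?eqxx in px1.
- by rewrite h ?eqxx in qx2.
Qed.

Lemma closed_sep n (X Y Z : aset k n) :
  closed_in X Z -> asubset Y X -> ~ asubset Y Z ->
  exists2 p, vanishes Z p & ~ vanishes Y p.
Proof.
move=> [E hE] YX /not_asubset[x Yx Zx].
have /not_zeros[p Ep px] : ~ zeros E x.
  by move=> h; apply: Zx; apply/hE; split=> //; apply: YX.
exists p; first by move=> z /hE[_ h]; apply: h.
by move=> h; rewrite h ?eqxx in px.
Qed.

Lemma chain_mono n (X : aset k n) r Z : irreducible_chain X r Z ->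
  forall i j, (i <= j <= r)%N -> asubset (Z i) (Z j).
Proof.
move=> [_ hZ] i; elim=> [|j IH] /andP[ij jr].
  by move: ij; rewrite leqn0 => /eqP ->.
move: ij; rewrite leq_eqVlt => /orP[/eqP -> //|ij] x Zx.
by apply: (proj1 (hZ j jr)); apply: IH Zx; rewrite -ltnS ij ltnW.
Qed.

(** ** The length of a chain *)

Definition free_on n (X : aset k n) (I : finType) (p : I -> {mpoly k[n]}) :=
  forall c : I -> k, (forall x, X x -> \sum_i c i * (p i).@[x 0] = 0) ->
  forall i, c i = 0.

(** In a vanishing combination of products [g ^ b * p i] on [Y], the lowest
    power of [g] that occurs can be cancelled because [Y] is irreducible; what
    remains restricts to a combination of the [p i] on [X]. *)
Lemma free_on_powers n (X Y : aset k n) (g : {mpoly k[n]}) (I : finType)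
    (p : I -> {mpoly k[n]}) D :
  irreducible Y -> asubset X Y -> vanishes X g -> ~ vanishes Y g ->
  free_on X p ->
  free_on Y (fun bi : 'I_D * I => g ^+ bi.1 * p bi.2).
Proof.
move=> irrY XY gX gY freeX c hc.
suff H b : forall b' : 'I_D, (b' < b)%N -> forall i, c (b', i) = 0.
  by case=> b i; apply: (H b.+1).
elim: b => [//|b IH] b'; rewrite ltnS leq_eqVlt => /orP[/eqP b'b|]; last exact: IH.
pose Q := \sum_(bi : 'I_D * I | (b <= bi.1)%N)
  c bi *: (g ^+ (bi.1 - b) * p bi.2).
have gQ : vanishes Y (g ^+ b * Q).
  move=> x Yx; rewrite -[RHS](hc x Yx) mulr_sumr raddf_sum /=.
  rewrite [RHS](bigID (fun bi : 'I_D * I => (b <= bi.1)%N)) /=.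
  rewrite [X in _ = _ + X]big1 ?addr0 => [|[b1 i]]; last first.
    by rewrite -ltnNge /= => b1b; rewrite IH ?mul0r.
  apply: eq_bigr => -[b1 i] /= bb1.
  by rewrite -scalerAr mevalZ mulrA -exprD subnKC.
have [/= gb|QY] := irreducible_prime irrY gQ.
  case: gY => x /gb/eqP; rewrite rmorphXn /= expf_eq0 => /andP[_ /eqP //].
move=> i; move: i; apply: freeX => x Xx.
rewrite -[RHS](QY _ (XY _ Xx)) /Q raddf_sum /=.
transitivity (\sum_(b1 < D | (b <= b1)%N) \sum_i
    (c (b1, i) *: (g ^+ (b1 - b) * p i)).@[x 0]); last first.
  by rewrite pair_big; apply: eq_big => [[b1 i]|[b1 i] _] /=; rewrite ?andbT.
rewrite (bigD1 b') /=; last by rewrite b'b.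
rewrite [X in _ = _ + X]big1 ?addr0 => [|b1 /andP[bb1 b1b']].
  by apply: eq_bigr => i _; rewrite b'b subnn expr0 mul1r mevalZ.
apply: big1 => i _; rewrite mevalZ mevalM rmorphXn /= (gX _ Xx) expr0n.
rewrite subn_eq0 -[(b1 <= b)%N]negbK -ltnNge.
by rewrite ltn_neqAle bb1 andbT -b'b eq_sym (inj_eq val_inj) b1b' mul0r mulr0.
Qed.

Lemma msizeM_bound n (p q : {mpoly k[n]}) :
  (msize (p * q) <= msize p + msize q + 1)%N.
Proof. by rewrite addn1 msizeM_le. Qed.

Lemma msizeX_bound n (p : {mpoly k[n]}) b :
  (msize (p ^+ b) <= b * (msize p + 1) + 1)%N.
Proof.
elim: b => [|b IH]; first by rewrite expr0 msize1.
rewrite exprS; apply: leq_trans (msizeM_bound _ _) _.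
by rewrite mulSn; lia.
Qed.

(** Successive members of a chain are separated by polynomials; the monomials in
    these with exponents below [D] are linearly independent on the top of the
    chain, by [free_on_powers]. Degrees are measured after the substitution of
    [lq], a polynomial parametrization, because the monomials will be counted on
    the parameter space. *)
Lemma chain_free n N (lq : N.-tuple {mpoly k[n]}) (X : aset k N) m Z :
  irreducible_chain X m Z -> exists E, forall D,
  exists (I : finType) (p : I -> {mpoly k[N]}),
  [/\ #|I| = (D ^ m)%N, free_on (Z m) p &
      forall i, (msize (p i \mPo lq) <= m * (D * E) + 1)%N].
Proof.
elim: m => [|m IH] chZ.
  exists 0%N => D; exists unit, (fun _ => 1); split.
  - by rewrite card_unit expn0.
  - have [[x Zx] _] := (chZ.1 0%N isT).2.
    by move=> c /(_ x Zx); rewrite (big_pred1 tt) => [|[]] //; rewrite meval1 mulr1 => h [].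
  - by move=> _; rewrite comp_mpoly1 msize1.
have [[cl irr] [sub nsub]] := (chZ.1 m.+1 (leqnn _), chZ.2 m (leqnn _)).
have [E hE] : exists E, forall D,
  exists (I : finType) (p : I -> {mpoly k[N]}),
  [/\ #|I| = (D ^ m)%N, free_on (Z m) p &
      forall i, (msize (p i \mPo lq) <= m * (D * E) + 1)%N].
  apply: IH; split=> i im; first by apply: chZ.1; apply: leqW.
  by apply: chZ.2; apply: leqW.
have Zm1X : asubset (Z m.+1) X by case: cl => F hF x /hF[].
have [g gZ gZ'] := closed_sep (chZ.1 m (leqnSn _)).1 Zm1X nsub.
have [E1 hE1] : exists E1, (msize (g \mPo lq) + 3 <= E1)%N by eexists.
exists (E + E1)%N => D; have [I [p [cI frp szp]]] := hE D.
exists ('I_D * I)%type, (fun bi : 'I_D * I => g ^+ bi.1 * p bi.2); split.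
- by rewrite card_prod card_ord cI expnS.
- exact: free_on_powers irr sub gZ gZ' frp.
case=> b i /=; rewrite rmorphM rmorphXn /=.
apply: leq_trans (msizeM_bound _ _) _.
have h1 := msizeX_bound (g \mPo lq) b.
have h2 := szp i.
have h3 : (b.+1 * E1 <= D * E1)%N by rewrite leq_mul2r ltn_ord orbT.
have h4 : (b * (msize (g \mPo lq) + 1) <= b * E1)%N by rewrite leq_mul2l; lia.
apply: leq_trans (leq_add (leq_add h1 h2) (leqnn 1)) _.
by rewrite mulSn !mulnDr; rewrite mulSn in h3; lia.
Qed.

Lemma free_on_card n (I : finType) (p : I -> {mpoly k[n]}) d :
  (forall c : I -> k, \sum_i c i *: p i = 0 -> forall i, c i = 0) ->
  (forall i, msize (p i) <= d)%N -> (#|I| <= d ^ n)%N.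
Proof.
move=> frp szp.
pose A := \matrix_(i < #|I|, m < #|{: 'X_{1..n < d}}|)
  (p (enum_val i))@_(enum_val m : 'X_{1..n < d}).
have : row_free A.
  rewrite -kermx_eq0; apply/rowV0P => u /sub_kermxP uA.
  have hu : \sum_i u 0 (enum_rank i) *: p i = 0.
    apply/mpolyP => m; rewrite mcoeff0 raddf_sum /=.
    have [md|dm] := ltnP (mdeg m) d; last first.
      apply: big1 => i _; rewrite mcoeffZ.
      have : m \notin msupp (p i) by apply: msize_mdeg_ge; apply: leq_trans dm.
      by rewrite mcoeff_msupp negbK => /eqP ->; rewrite mulr0.
    have /rowP/(_ (enum_rank (BMultinom md))) := uA.
    rewrite !mxE => uA0; rewrite -[RHS]uA0 [RHS](reindex _ (onW_bij _ (enum_rank_bij I))) /=.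
    by apply: eq_bigr => i _; rewrite mcoeffZ !mxE !enum_rankK.
  apply/rowP => j; rewrite mxE -[j]enum_valK.
  exact: (frp (fun i => u 0 (enum_rank i))).
move=> /eqP <-; apply: leq_trans (rank_leq_col _) _.
have lt_d (m : 'X_{1..n < d}) i : (m i < d)%N.
  by apply: leq_ltn_trans (bmdeg m); rewrite mdegE (bigD1 i) //= leq_addr.
have inj : injective (fun m : 'X_{1..n < d} => [ffun i => Ordinal (lt_d m i)]).
  move=> m1 m2 /ffunP E; apply/val_inj/mnmP => i.
  by have := congr1 val (E i); rewrite !ffunE.
by have := leq_card _ inj; rewrite card_ffun !card_ord.
Qed.

End Zariski.

(** * Dimension from charts *)

Section Charts.

Variable k : closedFieldType.

(** A parametrization of the part of [X] where [Delta] does not vanish by the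
    points of affine [n]-space, which is birational: the coordinates of the
    parameter are recovered as rational functions with denominator [Delta].
    No inverse of [Delta] occurs in [tau], so [tau] is defined everywhere. *)
Definition chart N n (X : aset k N) (tau : 'rV[k]_n -> 'rV[k]_N)
    (Delta : 'rV[k]_N -> k) :=
  [/\ polymx tau, polyfun Delta, forall y, X (tau y),
      forall x, X x -> Delta x != 0 -> exists y, tau y = x &
      exists q : 'rV[k]_N -> 'rV[k]_n,
        polymx q /\ forall y, q (tau y) = Delta (tau y) *: y].

(** Pulled back along [tau], the monomials of [chain_free] remain linearly
    independent, so there cannot be more of them than monomials of the same
    degree in [n] variables. *)
Lemma chart_chain_le N n (X Y : aset k N) (tau : 'rV[k]_n -> 'rV[k]_N) Delta
    m Z :
  chart X tau Delta -> asubset Y X -> irreducible_chain Y m Z ->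
  (exists2 x, Z 0%N x & Delta x != 0) -> (m <= n)%N.
Proof.
move=> [ptau [del hdel] _ surj _] YX chZ [x0 Zx0 dx0].
have [lq hlq] := polymx_tuple ptau.
have [E hE] := chain_free lq chZ.
(* D ^ n.+1 independent polynomials would have to fit into a space of dimension
   at most (D * C) ^ n, which this value of D excludes *)
pose C := (m * E + 1)%N; pose D := (C ^ n).+1.
have [I [p [cI frp szp]]] := hE D.
have [[F hF] irr] := chZ.1 m (leqnn m).
have ZmY : asubset (Z m) Y by move=> x /hF [].
have dZ : ~ vanishes (Z m) del.
  move=> h; case/eqP: dx0; rewrite hdel; apply: h.
  by apply: (chain_mono chZ) Zx0; rewrite leqnn.
have le1 : (#|I| <= (m * (D * E) + 1) ^ n)%N.
  apply: (@free_on_card _ _ I (fun i => p i \mPo lq)) (szp) => c hc.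
  apply: frp => x Zx.
  have : vanishes (Z m) (del * \sum_i c i *: p i).
    move=> z Zz; rewrite mevalM -hdel; have [->|dz] := eqVneq (Delta z) 0.
      by rewrite mul0r.
    have [y <-] := surj _ (YX _ (ZmY _ Zz)) dz.
    have c0 : (\sum_i c i *: p i) \mPo lq = 0.
      rewrite -[RHS]hc raddf_sum /=.
      by apply: eq_bigr => i _; rewrite comp_mpolyZ.
    by rewrite -hlq c0 meval0 mulr0.
  case/(irreducible_prime irr) => [//|/(_ x Zx) cx].
  rewrite -[RHS]cx raddf_sum /=.
  by apply: eq_bigr => i _; rewrite mevalZ.
rewrite leqNgt; apply/negP => nm.
have le2 : (D ^ n.+1 <= #|I|)%N by rewrite cI leq_pexp2l.
have le3 : ((m * (D * E) + 1) ^ n <= (D * C) ^ n)%N.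
  have : (m * (D * E) + 1 <= D * C)%N.
    by rewrite /C mulnDr muln1 mulnCA leq_add2l.
  by case: (n) => [|n'] le; rewrite ?expn0 ?leq_exp2r.
have := leq_trans le2 (leq_trans le1 le3).
by rewrite expnMn expnS mulnC leq_pmul2l ?ltnn // expn_gt0.
Qed.

(** The image of [flag_pt y0 i] is an affine subspace of dimension [i] through
    [y0]; these subspaces form a flag. *)
Definition flag_pt n (y0 : 'rV[k]_n) i (y : 'rV[k]_n) : 'rV[k]_n :=
  \row_j (if (j < i)%N then y 0 j else y0 0 j).

Lemma polymx_flag_pt n (y0 : 'rV[k]_n) i : polymx (flag_pt y0 i).
Proof.
move=> a j; apply: (@eq_polyfun _ _
  (fun y => if (j < i)%N then y 0 j else y0 0 j)) => [y|].
  by rewrite /flag_pt mxE.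
by case: (j < i)%N; [apply: polyfun_coord | apply: polyfun_const].
Qed.

(** The closure in [X] of the image of the [i]-th subspace of the flag. *)
Definition flag_set N n (X : aset k N) (tau : 'rV[k]_n -> 'rV[k]_N) y0 i :
    aset k N :=
  fun x => X x /\
    forall g : {mpoly k[N]}, (forall y, g.@[tau (flag_pt y0 i y) 0] = 0) ->
      g.@[x 0] = 0.

Lemma flag_setE N n (X : aset k N) (tau : 'rV[k]_n -> 'rV[k]_N) y0 i g :
  (forall y, X (tau y)) ->
  vanishes (flag_set X tau y0 i) g <-> forall y, g.@[tau (flag_pt y0 i y) 0] = 0.
Proof.
move=> Xtau; split=> [h y|h x [_ hx]]; last exact: hx.
by apply: h; split=> // g'; apply.
Qed.

(** The closures of the images of the subspaces of a flag form a chain; the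
    inclusions are strict because the parameters are rational functions on
    [X]. *)
Lemma chart_chain N n (X : aset k N) (tau : 'rV[k]_n -> 'rV[k]_N) Delta x :
  chart X tau Delta -> X x -> Delta x != 0 ->
  exists Z, irreducible_chain X n Z /\ Z 0%N x.
Proof.
move=> [ptau pdel Xtau surj [q [pq hq]]] Xx dx.
have [y0 ty0] := surj _ Xx dx.
have flag_y0 i : flag_pt y0 i y0 = y0.
  by apply/rowP => j; rewrite mxE if_same.
have ptf i : polymx (fun y => tau (flag_pt y0 i y)).
  exact: polymx_comp ptau (polymx_flag_pt y0 i).
exists (flag_set X tau y0); split; last first.
  by split=> // g /(_ y0); rewrite flag_y0 ty0.
split=> i ilen.
  split.
    exists (fun g => forall y, g.@[tau (flag_pt y0 i y) 0] = 0) => z.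
    by split=> -[Xz hz]; split.
  apply: prime_irreducible; first by exists (tau (flag_pt y0 i y0)); split.
  move=> g h /flag_setE gh.
  have [] := @polyfun_domain k n (fun y => g.@[tau (flag_pt y0 i y) 0])
    (fun y => h.@[tau (flag_pt y0 i y) 0]).
  - exact: (polyfun_comp (polyfun_meval g) (ptf i)).
  - exact: (polyfun_comp (polyfun_meval h) (ptf i)).
  - by move=> y; rewrite -mevalM gh.
  - by move=> g0; left; apply/flag_setE.
  - by move=> h0; right; apply/flag_setE.
split=> [z [Xz hz]|sub].
  split=> // g hg; apply: hz => y.
  have <- : flag_pt y0 i.+1 (flag_pt y0 i y) = flag_pt y0 i y.
    apply/rowP => j; rewrite !mxE; case: ltnP => // ij.
    by rewrite ltnNge (ltnW ij).
  exact: hg.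
pose j := Ordinal ilen.
(* this function is Delta * (y_i - (y0)_i) in the coordinates of the chart *)
have [g hg] : polyfun (fun z => q z 0 j - Delta z * y0 0 j).
  apply: polyfunD (pq 0 j) (polyfunN (polyfunM pdel (polyfun_const _ _))).
have hgy y : g.@[tau y 0] = Delta (tau y) * (y 0 j - y0 0 j).
  by rewrite -hg hq mxE mulrBr.
have gi : vanishes (flag_set X tau y0 i) g.
  by apply/flag_setE => // y; rewrite hgy mxE ltnn subrr mulr0.
have /flag_setE gi1 : vanishes (flag_set X tau y0 i.+1) g.
  by move=> z /sub /gi.
have [||y|h|h] := @polyfun_domain k n (fun y => Delta (tau (flag_pt y0 i.+1 y)))
    (fun y => y 0 j - y0 0 j).
- exact: polyfun_comp pdel (ptf _).
- exact: polyfunD (polyfun_coord _ _) (polyfunN (polyfun_const _ _)).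
- by have := gi1 Xtau y; rewrite hgy mxE ltnSn.
- by move: dx; rewrite -ty0 -(flag_y0 i.+1) h eqxx.
- have := h (\row_l (y0 0 l + 1)); rewrite mxE addrAC subrr add0r => /eqP.
  by rewrite oner_eq0.
Qed.

Lemma chart_has_dim_at N n (X : aset k N) (tau : 'rV[k]_n -> 'rV[k]_N) Delta x :
  chart X tau Delta -> X x -> Delta x != 0 -> has_dim_at X x n.
Proof.
move=> ch Xx dx; split; first exact: chart_chain ch Xx dx.
move=> m Z chZ Z0x; apply: (chart_chain_le ch _ chZ); first by move=> z.
by exists x.
Qed.

(** The neighbourhoods are allowed to depend on the point, so that openness can
    be witnessed by a determinant chosen at that point. *)
Definition locally_open N (X Y : aset k N) :=
  asubset Y X /\ forall x, Y x ->
    exists2 p : {mpoly k[N]}, p.@[x 0] != 0 &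
      forall z, X z -> p.@[z 0] != 0 -> Y z.

(** Closed irreducible subsets of [X] that meet the open set [Y] are determined
    by their traces on [Y]. *)
Lemma chain_restrict N (X Y : aset k N) n Z x :
  locally_open X Y -> irreducible_chain X n Z -> Z 0%N x -> Y x ->
  irreducible_chain Y n (fun i z => Z i z /\ Y z).
Proof.
move=> [YX opn] chZ Z0x Yx; have [p px hp] := opn _ Yx.
have Zx i : (i <= n)%N -> Z i x by move=> im; apply: (chain_mono chZ) Z0x.
have vanE i g : (i <= n)%N -> vanishes (fun z => Z i z /\ Y z) g -> vanishes (Z i) g.
  move=> im h; have [[E hE] irr] := chZ.1 i im.
  have /(irreducible_prime irr)[/(_ x (Zx _ im))/eqP|//] : vanishes (Z i) (p * g).
    move=> z Zz; rewrite mevalM; have [->|pz] := eqVneq p.@[z 0] 0.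
      by rewrite mul0r.
    by rewrite h ?mulr0 //; split=> //; apply: hp pz; case/hE: Zz.
  by rewrite (negPf px).
split=> i im.
  have [[E hE] irr] := chZ.1 i im; split.
    exists E => z; split=> [[/hE[_ h] Yz]|[Yz h]]; split=> //.
    by apply/hE; split=> //; apply: YX.
  apply: prime_irreducible; first by exists x; split=> //; apply: Zx.
  move=> g h /vanE/(irreducible_prime irr) [//|gv|hv]; [left | right].
    by move=> z [/gv].
  by move=> z [/hv].
have [sub nsub] := chZ.2 i im.
split=> [z [Zz Yz]|sub']; first by split=> //; apply: sub.
have ZX : asubset (Z i.+1) X by have [[E hE] _] := chZ.1 i.+1 im; move=> z /hE[].
have [g gi gi1] := closed_sep (chZ.1 i (ltnW im)).1 ZX nsub.
by apply: gi1; apply: vanE => // z /sub'[/gi].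
Qed.

Lemma charts_has_dim N n (X Y : aset k N) :
  locally_open X Y -> (exists x, Y x) ->
  (forall x, Y x -> exists (tau : 'rV[k]_n -> 'rV[k]_N) Delta,
     chart X tau Delta /\ Delta x != 0) ->
  has_dim Y n.
Proof.
move=> opn [x Yx] charts; split.
  have [tau [Delta [ch dx]]] := charts _ Yx.
  have [Z [chZ Zx]] := chart_chain ch (opn.1 _ Yx) dx.
  by exists (fun i z => Z i z /\ Y z); apply: chain_restrict opn chZ Zx Yx.
move=> m Z chZ; have [[E hE] [[z Zz] _]] := chZ.1 0%N isT.
have Yz : Y z by case/hE: Zz.
have [tau [Delta [ch dz]]] := charts _ Yz.
by apply: (chart_chain_le ch opn.1 chZ); exists z.
Qed.

Lemma has_dim_affine n : has_dim (@asetT k n) n.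
Proof.
apply: (@charts_has_dim n n (@asetT k n)).
- split=> // x _; exists 1 => //; by rewrite meval1 oner_eq0.
- by exists 0.
move=> x _; exists id, (fun _ => 1); split; last exact: oner_neq0.
split=> //; first exact: polymx_id.
- exact: polyfun_const.
- by move=> z _ _; exists z.
- by exists id; split=> [|y]; [apply: polymx_id | rewrite scale1r].
Qed.

End Charts.

(** * Kernel bundles *)

Section LinearOff.

Variables (k : fieldType) (N : nat) (B : pred 'I_N).

(** [p] is linear in the coordinates outside [B], with coefficients that are
    polynomials in the coordinates in [B]; these coefficients are then the
    partial derivatives of [p]. *)
Definition linear_off (p : {mpoly k[N]}) :=
  (forall x : 'rV[k]_N,
     p.@[x 0] = \sum_(j | ~~ B j) x 0 j * (mderiv j p).@[x 0]) /\
  (forall (x x' : 'rV[k]_N) j, ~~ B j -> (forall b, B b -> x 0 b = x' 0 b) ->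
     (mderiv j p).@[x 0] = (mderiv j p).@[x' 0]).

Lemma linear_off0 : linear_off 0.
Proof.
split=> [x|x x' j _ _]; last by rewrite mderiv0 !meval0.
by rewrite meval0 big1 // => j _; rewrite mderiv0 meval0 mulr0.
Qed.

Lemma linear_offD p q : linear_off p -> linear_off q -> linear_off (p + q).
Proof.
move=> [p1 p2] [q1 q2]; split=> [x|x x' j nBj xx'].
  rewrite mevalD p1 q1 -big_split /=; apply: eq_bigr => j _.
  by rewrite mderivD mevalD mulrDr.
by rewrite mderivD !mevalD (p2 x x') ?(q2 x x').
Qed.

Lemma linear_off_sum (I : finType) (p : I -> {mpoly k[N]}) :
  (forall i, linear_off (p i)) -> linear_off (\sum_i p i).
Proof.
by move=> h; apply: big_ind => //; [apply: linear_off0 | apply: linear_offD].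
Qed.

Lemma linear_offZ c p : linear_off p -> linear_off (c%:MP * p).
Proof.
move=> [p1 p2]; rewrite mul_mpolyC; split=> [x|x x' j nBj xx'].
  rewrite mevalZ p1 mulr_sumr; apply: eq_bigr => j _.
  by rewrite mderivZ mevalZ mulrCA.
by rewrite mderivZ !mevalZ (p2 x x').
Qed.

Lemma mderivXU i j : mderiv i ('X_j : {mpoly k[N]}) = (i == j)%:R.
Proof.
rewrite mderivX mnm1E eq_sym; case: eqP => [->|_]; last by rewrite scale0r.
rewrite scale1r -[RHS]mpolyX0; congr 'X_[_].
by apply/mnmP => l; rewrite mnmBE mnm0E subnn.
Qed.

Lemma linear_offX j : ~~ B j -> linear_off 'X_j.
Proof.
move=> nBj; split=> [x|x x' i _ _]; last by rewrite mderivXU !rmorph_nat.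
rewrite mevalXU (bigD1 j) //= big1 ?addr0 => [|i /andP[_ /negPf ij]].
  by rewrite mderivXU eqxx meval1 mulr1.
by rewrite mderivXU ij meval0 mulr0.
Qed.

Lemma linear_offXX b j : B b -> ~~ B j -> linear_off ('X_b * 'X_j).
Proof.
move=> Bb nBj.
have dE i : ~~ B i -> mderiv i ('X_b * 'X_j : {mpoly k[N]}) = (i == j)%:R * 'X_b.
  move=> nBi; rewrite mderivM !mderivXU.
  have /negPf -> : i != b by apply: contraNneq nBi => ->.
  by rewrite mul0r add0r mulrC.
split=> [x|x x' i nBi xx'].
  rewrite mevalM !mevalXU (bigD1 j) //= big1 ?addr0 => [|i /andP[nBi /negPf ij]].
    by rewrite dE // eqxx mul1r mevalXU mulrC.
  by rewrite dE // ij mul0r meval0 mulr0.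
by rewrite dE // !mevalM !mevalXU !rmorph_nat xx'.
Qed.

End LinearOff.

Section KernelBundle.

Variables (k : closedFieldType) (N r : nat) (B : pred 'I_N).
Variable P : 'I_r -> {mpoly k[N]}.
Hypothesis linP : forall e, linear_off B (P e).

Variable E : equations k N.
Hypothesis EP : forall p, E p <-> exists e, p = P e.

Definition proj_on : 'M[k]_N := diag_mx (\row_j (B j)%:R).
Local Notation pB := proj_on.
Local Notation pF := (1%:M - pB).

Definition coef_mx (x : 'rV[k]_N) : 'M[k]_(N, r) :=
  \matrix_(j, e) (if B j then 0 else (mderiv j (P e)).@[x 0]).

(** Full rank is expressed by a right inverse, since the charts are built from
    one. The right inverse takes values in the fibre directions only, so adding
    these values to a point does not change its base point. *)
Definition full_rank_at (x : 'rV[k]_N) :=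
  exists R : 'M[k]_(r, N), R *m pB = 0 /\ R *m coef_mx x = 1%:M.

Lemma proj_onE m (A : 'M[k]_(m, N)) i j : (A *m pB) i j = A i j * (B j)%:R.
Proof. by rewrite mul_mx_diag !mxE. Qed.

Lemma proj_on_id : pB *m pB = pB.
Proof.
apply/matrixP => i j; rewrite proj_onE !mxE; case: eqP => [->|_].
  by case: (B j); rewrite ?mulr1 ?mulr0.
by rewrite mul0r.
Qed.

Lemma proj_on_coef x : pB *m coef_mx x = 0.
Proof.
apply/matrixP => j e; rewrite mul_diag_mx !mxE.
by case: (B j); rewrite ?mulr0 ?mul0r.
Qed.

Lemma coef_mx_eq x x' : x *m pB = x' *m pB -> coef_mx x = coef_mx x'.
Proof.
move=> xx'; apply/matrixP => j e; rewrite !mxE; case: ifP => // /negbT nBj.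
apply: (linP e).2 => // b Bb.
by have /rowP/(_ b) := xx'; rewrite !proj_onE Bb !mulr1.
Qed.

Lemma meval_coef_mx (x : 'rV[k]_N) e : (P e).@[x 0] = (x *m coef_mx x) 0 e.
Proof.
rewrite (linP e).1 mxE [RHS](bigID B) /= [X in _ = X + _]big1 ?add0r => [|j Bj].
  by apply: eq_bigr => j nBj; rewrite mxE (negPf nBj).
by rewrite mxE Bj mulr0.
Qed.

Lemma zerosE x : zeros E x <-> x *m coef_mx x = 0.
Proof.
split=> [h|h p /EP[e ->]]; last by rewrite meval_coef_mx h mxE.
by apply/rowP => e; rewrite -meval_coef_mx mxE; apply: h; apply/EP; exists e.
Qed.

Lemma polymx_coef_mx : polymx coef_mx.
Proof.
move=> j e; apply: (@eq_polyfun _ _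
  (fun x => if B j then 0 else (mderiv j (P e)).@[x 0])) => [x|].
  by rewrite /coef_mx mxE.
by case: (B j); [apply: polyfun_const | apply: polyfun_meval].
Qed.

Lemma full_rank_atP x :
  (forall w : 'rV[k]_r, exists v : 'rV[k]_N,
     v *m pB = 0 /\ v *m coef_mx x = w) -> full_rank_at x.
Proof.
move=> H; have [v hv] : exists v : 'I_r -> 'rV[k]_N, forall i,
    v i *m pB = 0 /\ v i *m coef_mx x = delta_mx 0 i.
  exact: (fin_all_exists (P := fun i v => v *m pB = 0 /\
    v *m coef_mx x = delta_mx 0 i) (fun i => H _)).
exists (\matrix_i v i); split; apply/row_matrixP => i; rewrite row_mul rowK.
  by rewrite (hv i).1 row0.
by rewrite (hv i).2 row1.
Qed.

Lemma full_rank_le x : full_rank_at x -> (r <= N)%N.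
Proof.
move=> [R [_ RS]]; rewrite -(mxrank1 k r) -RS.
exact: leq_trans (mxrankM_maxl _ _) (rank_leq_col _).
Qed.

Section Retraction.

Variable R : 'M[k]_(r, N).
Hypothesis RB : R *m pB = 0.

Definition minor z := \det (R *m coef_mx z).

(** Outside [B] this is [minor z] times the projection of [z] onto the kernel
    of [coef_mx z] along the rows of [R]. Multiplying by the minor avoids a
    division and stays in the kernel, which is a linear space. *)
Definition kernel_pt (z : 'rV[k]_N) : 'rV[k]_N :=
  z *m pB + minor z *: (z *m pF)
  - z *m coef_mx z *m \adj (R *m coef_mx z) *m R.

Lemma polyfun_minor : polyfun minor.
Proof.
apply: polyfun_det; apply: polymxM; last exact: polymx_coef_mx.
exact: polymx_const.
Qed.

Lemma polymx_kernel_pt : polymx kernel_pt.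
Proof.
have lin (A : 'M[k]_N) : polymx (fun z : 'rV[k]_N => z *m A).
  by apply: polymxM; [apply: polymx_id | apply: polymx_const].
apply: polymxD; first apply: polymxD (lin _) (polymxZ polyfun_minor (lin _)).
apply: polymxN; apply: polymxM (polymx_const _ _); apply: polymxM.
  exact: polymxM (@polymx_id _ _) polymx_coef_mx.
apply: polymx_adj; apply: polymxM polymx_coef_mx; exact: polymx_const.
Qed.

Lemma kernel_pt_on z : kernel_pt z *m pB = z *m pB.
Proof.
rewrite /kernel_pt mulmxBl mulmxDl -scalemxAl -!mulmxA RB !mulmx0 subr0.
by rewrite mulmxBl mul1mx proj_on_id subrr mulmx0 scaler0 addr0.
Qed.

Lemma kernel_pt_off z : kernel_pt z *m pF =
  minor z *: (z *m pF) - z *m coef_mx z *m \adj (R *m coef_mx z) *m R.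
Proof.
rewrite mulmxBr mulmx1 kernel_pt_on /kernel_pt.
by rewrite addrAC (addrC (z *m pB)) addrK.
Qed.

Lemma mul_off_coef (z x : 'rV[k]_N) : z *m pF *m coef_mx x = z *m coef_mx x.
Proof. by rewrite mulmxBr mulmx1 mulmxBl -!mulmxA proj_on_coef mulmx0 subr0. Qed.

Lemma kernel_pt_zeros z : zeros E (kernel_pt z).
Proof.
apply/zerosE; rewrite (coef_mx_eq (kernel_pt_on z)) /kernel_pt mulmxBl mulmxDl.
rewrite -[z *m pB *m _]mulmxA proj_on_coef mulmx0 add0r -scalemxAl mul_off_coef.
rewrite -[_ *m R *m _]mulmxA -[_ *m \adj _ *m _]mulmxA mul_adj_mx.
by rewrite mul_mx_scalar subrr.
Qed.

(** Over the base point of [x], shrinking the fibre coordinates of [x] by the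
    minor compensates the factor in [kernel_pt]; moving the point by a
    combination of the rows of [R] changes nothing. *)
Lemma kernel_pt_surj x (u : 'rV[k]_r) : zeros E x -> minor x != 0 ->
  kernel_pt (x *m pB + (minor x)^-1 *: (x *m pF) - u *m R) = x.
Proof.
move=> /zerosE x0 dx; set z := _ - _.
have FB : pF *m pB = 0 by rewrite mulmxBl mul1mx proj_on_id subrr.
have zB : z *m pB = x *m pB.
  rewrite mulmxBl mulmxDl -scalemxAl -!mulmxA FB RB proj_on_id.
  by rewrite !mulmx0 scaler0 addr0 subr0.
have cz : coef_mx z = coef_mx x by apply: coef_mx_eq.
have RF : R *m pF = R by rewrite mulmxBr mulmx1 RB subr0.
have zF : z *m pF = (minor x)^-1 *: (x *m pF) - u *m R.
  by rewrite mulmxBr mulmx1 zB /z addrAC (addrC (x *m pB)) addrK.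
rewrite /kernel_pt /minor cz zB -mul_off_coef zF -/(minor x).
rewrite mulmxBl -scalemxAl mul_off_coef x0 scaler0 sub0r !mulNmx opprK.
rewrite -[u *m R *m _]mulmxA -[_ *m \adj _]mulmxA mul_mx_adj mul_mx_scalar.
rewrite -scalemxAl scalerBr scalerA divff // scale1r -/(minor x) -addrA subrK.
by rewrite mulmxBr mulmx1 addrC subrK.
Qed.

End Retraction.

(** At a point of full rank, a right inverse [R] splits the affine space into
    the span of the rows of [R] and the kernel of the system at that point; the
    latter, of dimension [N - r], provides the parameters. *)
Lemma kernel_chart x0 : full_rank_at x0 ->
  exists (tau : 'rV[k]_(N - r) -> 'rV[k]_N) Delta,
    chart (zeros E) tau Delta /\ Delta x0 != 0.
Proof.
move=> [R [RB RS]]; pose S := coef_mx x0.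
have rS : \rank S = r by apply/eqP/row_fullP; exists R.
have En : \rank (kermx S) = (N - r)%N by rewrite mxrank_ker rS.
rewrite -En; pose J := row_base (kermx S).
have JS : J *m S = 0 by apply/sub_kermxP; rewrite eq_row_base.
have [A AJ] : exists A, 1%:M - S *m R = A *m J.
  apply/submxP; rewrite eq_row_base; apply/sub_kermxP.
  by rewrite mulmxBl mul1mx -mulmxA RS mulmx1 subrr.
have Jinj m (C D : 'M_(m, _)) : C *m J = D *m J -> C = D.
  by move=> CJ; apply: (row_free_inj (row_base_free (kermx S))).
have JA : J *m A = 1%:M.
  by apply: Jinj; rewrite -mulmxA -AJ mulmxBr mulmx1 mulmxA JS mul0mx subr0 mul1mx.
have RA : R *m A = 0.
  apply: Jinj; rewrite -mulmxA -AJ mulmxBr mulmx1 mulmxA RS mul1mx subrr.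
  by rewrite mul0mx.
have RF : R *m pF = R by rewrite mulmxBr mulmx1 RB subr0.
exists (fun y => kernel_pt R (y *m J)), (minor R); split; last first.
  by rewrite /minor RS det1 oner_neq0.
split.
- apply: polymx_comp (polymx_kernel_pt R) _.
  exact: polymxM (@polymx_id _ _) (polymx_const _ _).
- exact: polyfun_minor.
- by move=> y; apply: kernel_pt_zeros.
- move=> x x0' dx.
  pose x' := x *m pB + (minor R x)^-1 *: (x *m pF).
  exists (x' *m A).
  rewrite -mulmxA -AJ mulmxBr mulmx1 mulmxA.
  exact: kernel_pt_surj.
exists (fun x => minor R x *: (x *m pB *m A) + x *m pF *m A); split.
  have lin (C : 'M[k]_N) : polymx (fun z : 'rV[k]_N => z *m C *m A).
    apply: polymxM; last exact: polymx_const.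
    by apply: polymxM; [apply: polymx_id | apply: polymx_const].
  exact: polymxD (polymxZ (polyfun_minor _) (lin _)) (lin _).
move=> y; rewrite kernel_pt_on // kernel_pt_off // mulmxBl -[_ *m R *m A]mulmxA.
rewrite RA mulmx0 subr0 -scalemxAl.
have -> : minor R (kernel_pt R (y *m J)) = minor R (y *m J).
  by rewrite /minor (coef_mx_eq (kernel_pt_on RB _)).
rewrite -scalerDr -mulmxDl -mulmxDr addrC subrK mulmx1 -mulmxA JA.
by rewrite mulmx1.
Qed.

(** [kernel_pt] carries [x] polynomially into the fibres over all base points,
    so an open set that contains [x] meets the fibres over a nonempty open set
    of base points. *)
Lemma lift_nearby x (g : {mpoly k[N]}) :
  full_rank_at x -> zeros E x -> g.@[x 0] != 0 ->
  exists H : 'rV[k]_N -> k, [/\ polyfun H, H x != 0 &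
    forall z, H z != 0 ->
      exists w, [/\ zeros E w, w *m pB = z *m pB & g.@[w 0] != 0]].
Proof.
move=> [R [RB RS]] x0 gx.
pose f z := z *m pB + (minor R x)^-1 *: (x *m pF).
have fB z : f z *m pB = z *m pB.
  rewrite mulmxDl -scalemxAl -!mulmxA mulmxBl mul1mx proj_on_id subrr.
  by rewrite mulmx0 scaler0 addr0.
exists (fun z => g.@[kernel_pt R (f z) 0]); split.
- apply: (polyfun_comp (polyfun_meval g)); apply: polymx_comp (polymx_kernel_pt R) _.
  apply: polymxD (polymx_const _ _).
  exact: polymxM (@polymx_id _ _) (polymx_const _ _).
- have := @kernel_pt_surj R RB x 0 x0; rewrite mul0mx subr0 => -> //.
  by rewrite /minor RS det1 oner_neq0.
move=> z gz; exists (kernel_pt R (f z)); split=> //.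
  exact: kernel_pt_zeros.
by rewrite kernel_pt_on.
Qed.

(** Two nonempty open sets meet the fibre over a common base point, because
    the base is an affine space; this fibre is a linear space, so they meet on
    the line through two of its points. *)
Lemma kernel_bundle_irreducible Y :
  locally_open (zeros E) Y -> (exists x, Y x) ->
  (forall x, Y x -> full_rank_at x) -> irreducible Y.
Proof.
move=> [YX opn] Y0 good; apply: prime_irreducible => // p q pq.
apply: NNPP => /not_or_and[/not_vanishes[x Yx px] /not_vanishes[y Yy qy]].
have [ox oxx hox] := opn _ Yx.
have [|H1 [pH1 H1x lift1]] := @lift_nearby x (p * ox) (good _ Yx) (YX _ Yx).
  by rewrite mevalM mulf_neq0.
have [H2 [pH2 H2y lift2]] := lift_nearby (good _ Yy) (YX _ Yy) qy.
have [z H1z H2z] := polyfun_common_nonzero pH1 pH2 H1x H2y.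
have [w1 [/zerosE w10 w1B gw1]] := lift1 _ H1z.
have [w2 [/zerosE w20 w2B gw2]] := lift2 _ H2z.
pose l (c : 'rV[k]_1) := w1 + c 0 0 *: (w2 - w1).
have pl : polymx l.
  apply: polymxD; first exact: polymx_const.
  by apply: polymxZ; [apply: polyfun_coord | apply: polymx_const].
have l0 : l 0 = w1 by rewrite /l mxE scale0r addr0.
have l1 : l (const_mx 1) = w2 by rewrite /l mxE scale1r addrC subrK.
have [||c] := @polyfun_common_nonzero k 1 (fun c => (p * ox).@[l c 0])
    (fun c => q.@[l c 0]) 0 (const_mx 1)
    (polyfun_comp (polyfun_meval _) pl) (polyfun_comp (polyfun_meval _) pl).
- by rewrite l0.
- by rewrite l1.
rewrite mevalM mulf_eq0 negb_or => /andP[pc oc] qc.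
have lB : l c *m pB = w1 *m pB.
  by rewrite mulmxDl -scalemxAl mulmxBl w1B w2B subrr scaler0 addr0.
have lX : zeros E (l c).
  apply/zerosE; rewrite (coef_mx_eq lB) mulmxDl -scalemxAl mulmxBl w10.
  rewrite (@coef_mx_eq w1 w2) ?w1B ?w2B // w20.
  by rewrite subrr scaler0 addr0.
have /eqP := pq _ (hox _ lX oc).
by rewrite mevalM mulf_eq0 (negPf pc) (negPf qc).
Qed.

Lemma kernel_bundle_tangent x : full_rank_at x -> has_tangent_dim E x (N - r).
Proof.
move=> [R [RB RS]].
pose Jac := \matrix_(j < N, e < r) (mderiv j (P e)).@[x 0].
have JacF : pF *m Jac = coef_mx x.
  rewrite mulmxBl mul1mx; apply/matrixP => j e.
  rewrite mul_diag_mx !mxE.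
  by case: (B j); rewrite ?mul1r ?mul0r ?subrr ?subr0.
have RJ : R *m Jac = 1%:M.
  by rewrite -RS -JacF mulmxA mulmxBr mulmx1 RB subr0.
pose f : 'Hom('rV[k]_N, 'rV[k]_r) := linfun (mulmxr Jac).
exists (lker f); split=> [v|].
  rewrite memv_ker lfunE /=; split=> [/eqP vJ p /EP[e ->]|tg].
    have /rowP/(_ e) := vJ; rewrite !mxE => vJe; rewrite -[RHS]vJe.
    by apply: eq_bigr => j _; rewrite !mxE mulrC.
  apply/eqP/rowP => e; rewrite !mxE -[RHS](tg (P e)); last by apply/EP; exists e.
  by apply: eq_bigr => j _; rewrite !mxE mulrC.
have full : (f @: fullv)%VS = fullv.
  apply/eqP; rewrite eqEsubv subvf; apply/subvP => w _.
  by rewrite -[w](_ : f (w *m R) = w) ?memv_img ?memvf // lfunE /= -mulmxA RJ mulmx1.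
have := limg_ker_dim f fullv; rewrite full capfv !dimvf /dim /= !mul1n => dimN.
by apply/eqP; rewrite -(eqn_add2r r) dimN subnK // -dimN leq_addl.
Qed.

Lemma kernel_bundle_smooth x :
  full_rank_at x -> zeros E x -> smooth_at E x.
Proof.
move=> fx x0; exists (N - r)%N; split; last exact: kernel_bundle_tangent.
have [tau [Delta [ch dx]]] := kernel_chart fx.
exact: chart_has_dim_at ch x0 dx.
Qed.

Lemma kernel_bundle_has_dim Y :
  locally_open (zeros E) Y -> (exists x, Y x) ->
  (forall x, Y x -> full_rank_at x) -> has_dim Y (N - r).
Proof.
move=> opn Y0 good; apply: (charts_has_dim opn Y0) => x /good.
exact: kernel_chart.
Qed.

End KernelBundle.

(** * Extensions of quiver representations *)

Section Extensions.

Variables (k : fieldType) (Q : quiver) (t : vert Q -> nat) (T : rep k t).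
Hypothesis hExt : ext1_eq0 T T.

(** The family [xi] is the off-diagonal part of an extension of [T] by itself;
    the upper half of a splitting of this extension writes [xi] as a
    coboundary. *)
Lemma ext1_coboundary (xi : rep k t) :
  exists h : vmap k t t, forall a, xi a = h (tgt a) *m T a - T a *m h (src a).
Proof.
pose e (i : vert Q) := (t i + t i)%N.
pose E : rep k e := fun a => block_mx (T a) (xi a) 0 (T a).
pose f : vmap k t e := fun i => col_mx 1%:M 0.
pose g : vmap k e t := fun i => row_mx 0 1%:M.
have [|h [hE gh]] := @hExt e E f g.
  split.
  - by move=> a; rewrite mul_col_mx mul_block_col !mulmx0 !mul1mx !mul0mx mulmx1 !addr0.
  - by move=> a; rewrite mul_mx_row mul_row_block !mulmx0 !mul1mx !mul0mx mulmx1 !add0r.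
  - move=> i u; rewrite mul_col_mx mul1mx mul0mx => /(congr1 usubmx).
    by rewrite col_mxKu linear0.
  - move=> i v; rewrite -[v]vsubmxK mul_row_col mul0mx add0r mul1mx; split.
      by move=> ->; exists (usubmx v); rewrite mul_col_mx mul1mx mul0mx.
    by move=> [u]; rewrite mul_col_mx mul0mx => /eq_col_mx [].
  - by move=> i w; exists (col_mx 0 w); rewrite mul_row_col mul0mx add0r mul1mx.
have hd i : dsubmx (h i) = 1%:M.
  by rewrite -(gh i) -{2}[h i]vsubmxK mul_row_col mul0mx add0r mul1mx.
exists (fun i => usubmx (h i)) => a.
have := congr1 usubmx (hE a).
rewrite -[h (src a)]vsubmxK -{1}[h (tgt a)]vsubmxK !hd mul_col_mx mul_block_col.
by rewrite !col_mxKu mulmx1 => ->; rewrite addrAC subrr add0r.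
Qed.

(** A cocycle with values in [M] lifts along a surjection from a power of [T],
    and its components are coboundaries; hence so is the cocycle. *)
Lemma quotient_coboundary (d : vert Q -> nat) (M : rep k d) s
    (p : 'I_s -> vmap k t d) :
  (forall c, is_hom T M (p c)) ->
  (forall i, \rank (\mxrow_(c < s) p c i) = d i) ->
  forall eta : mxfam k (fun a => d (tgt a)) (fun a => t (src a)),
  exists h : vmap k t d, forall a, M a *m h (src a) - h (tgt a) *m T a = eta a.
Proof.
move=> homp surj eta.
have [G hG] : exists G : forall i, 'M[k]_(_, d i),
    forall i, \mxrow_(c < s) p c i *m G i = 1%:M.
  apply: (fin_all_exists (P := fun i G => \mxrow_(c < s) p c i *m G = 1%:M)) => i.
  by apply/row_freeP; rewrite /row_free surj.
pose xi c : rep k t := fun a => - submxcol (G (tgt a) *m eta a) c.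
have [h hh] : exists h : 'I_s -> vmap k t t,
    forall c a, xi c a = h c (tgt a) *m T a - T a *m h c (src a).
  exact: (fin_all_exists (P := fun c h =>
    forall a, xi c a = h (tgt a) *m T a - T a *m h (src a))
    (fun c => ext1_coboundary (xi c))).
exists (fun i => \sum_c p c i *m h c i) => a.
transitivity (\sum_c p c (tgt a) *m submxcol (G (tgt a) *m eta a) c); last first.
  by rewrite -mul_mxrow_mxcol submxcolK mulmxA hG mul1mx.
rewrite mulmx_sumr mulmx_suml -sumrB; apply: eq_bigr => c _.
rewrite -[submxcol _ _]opprK -/(xi c a) hh opprB mulmxBr !mulmxA.
by rewrite (homp c a).
Qed.

End Extensions.

(** * The equations of the one-point extension *)

Section Coordinates.

Lemma card_coord (J : finType) (m n : J -> nat) :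
  #|Defs.coord m n| = (\sum_j m j * n j)%N.
Proof.
rewrite card_tagged sumnE big_map big_enum /=.
by apply: eq_bigr => j _; rewrite card_prod !card_ord.
Qed.

Definition point_of (R : Type) (J : finType) (m n : J -> nat) (X : mxfam R m n) :
    'rV[R]_#|Defs.coord m n| :=
  \row_c X (tag (enum_val c)) (tagged (enum_val c)).1 (tagged (enum_val c)).2.

Lemma point_ofK (R : Type) (J : finType) (m n : J -> nat) (X : mxfam R m n) j :
  fam_of_fun (point_of X ord0) j = X j.
Proof. by apply/matrixP => p q; rewrite !mxE enum_rankK. Qed.

End Coordinates.

Lemma meval_sum (R : nzRingType) n (v : 'I_n -> R) (I : finType)
    (F : I -> {mpoly R[n]}) : (\sum_i F i).@[v] = \sum_i (F i).@[v].
Proof. exact: raddf_sum. Qed.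

Section OnePointEquations.

Variables (k : closedFieldType) (Q : quiver) (t : vert Q -> nat) (T : rep k t).
Variables (s : nat) (d : vert Q -> nat).

Local Notation D := (ext_dim (t := t) s d).
Local Notation N := #|rep_coord D|.

Lemma relatorE (R : nzRingType) (X : rep R D) (S : rep R t) a l r c :
  relator X S l r c =
    \sum_q X (inl a) r q * rho X l q c - \sum_m S a m l * rho X m r c.
Proof.
rewrite /relator !mxE; congr (_ - _).
by rewrite summxE; apply: eq_bigr => m _; rewrite mxE.
Qed.

Definition base_coord : pred 'I_N :=
  fun j => if tag (enum_val j) is inl _ then true else false.

Definition eq_index : finType :=
  {a : arr Q & ('I_(t (src a)) * 'I_(d (tgt a)) * 'I_s)%type}.

Definition one_point_eq (e : 'I_#|eq_index|) : {mpoly k[N]} :=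
  let: existT a (l, r, c) := enum_val e in
  relator (@generic_rep k Q t s d) (fun b => map_mx (fun z => z%:MP) (T b)) l r c.

Lemma one_point_eqsP p : one_point_eqs T s d p <-> exists e, p = one_point_eq e.
Proof.
split=> [[a [l [r [c ->]]]]|[e ->]].
  exists (enum_rank (Tagged (fun a => ('I_(t (src a)) * 'I_(d (tgt a)) * 'I_s)%type)
    (l, r, c))).
  by rewrite /one_point_eq enum_rankK.
by rewrite /one_point_eq; case: (enum_val e) => a [[l r] c]; exists a, l, r, c.
Qed.

Lemma meval_one_point_eq (x : 'rV[k]_N) e :
  (one_point_eq e).@[x 0] =
  let: existT a (l, r, c) := enum_val e in relator (rep_point x) T l r c.
Proof.
rewrite /one_point_eq; case: (enum_val e) => a [[l r] c] /=.
rewrite !relatorE mevalB; congr (_ - _); rewrite meval_sum; apply: eq_bigr => q _.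
  by rewrite mevalM !mxE !mevalXU.
by rewrite mevalM !mxE mevalXU mevalC.
Qed.

Lemma linear_off_one_point_eq e : linear_off base_coord (one_point_eq e).
Proof.
rewrite /one_point_eq; case: (enum_val e) => a [[l r] c] /=.
rewrite relatorE -sumrN; apply: linear_offD; apply: linear_off_sum => q.
  by rewrite !mxE; apply: linear_offXX; rewrite /base_coord enum_rankK.
rewrite -mulNr !mxE -mpolyCN; apply: linear_offZ; apply: linear_offX.
by rewrite /base_coord enum_rankK.
Qed.

(** The component [T -> M] of a point of the representation space at the
    [c]-th basis vector of the vector space at the new vertex. *)
Definition hom_comp (X : rep k D) (c : 'I_s) : vmap k t d :=
  fun i => \matrix_(r, l) rho X l r c.

Lemma relator_hom_comp (X : rep k D) a l r c :
  relator X T l r c =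
  (X (inl a) *m hom_comp X c (src a) - hom_comp X c (tgt a) *m T a) r l.
Proof.
rewrite relatorE !mxE; congr (_ - _); apply: eq_bigr => q _; rewrite !mxE //.
by rewrite mulrC.
Qed.

Lemma zeros_one_point (x : 'rV[k]_N) : zeros (one_point_eqs T s d) x <->
  forall c, is_hom T (base_part (rep_point x)) (hom_comp (rep_point x) c).
Proof.
split=> [h c a|h p /one_point_eqsP[e ->]].
  apply/eqP; rewrite eq_sym -subr_eq0; apply/eqP/matrixP => r l.
  rewrite [RHS]mxE.
  transitivity (relator (rep_point x) T l r c); first by rewrite relator_hom_comp.
  pose e := enum_rank (Tagged (fun a =>
    ('I_(t (src a)) * 'I_(d (tgt a)) * 'I_s)%type) (l, r, c)).
  have := h (one_point_eq e); rewrite meval_one_point_eq enum_rankK; apply.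
  by apply/one_point_eqsP; exists e.
rewrite meval_one_point_eq; case: (enum_val e) => a [[l r] c] /=.
by rewrite relator_hom_comp (h c a) subrr mxE.
Qed.

Hypothesis hExt : ext1_eq0 T T.

(** The system of equations at [M] is the coboundary map whose cokernel is the
    space of extensions of [M] by copies of [T]. *)
Lemma full_rank_one_point (x : 'rV[k]_N) :
  zeros (one_point_eqs T s d) x -> has_rank (hom_part (rep_point x)) d ->
  full_rank_at base_coord one_point_eq x.
Proof.
move=> /zeros_one_point homx surj; apply: full_rank_atP => w.
pose eta c : mxfam k (fun a => d (tgt a)) (fun a => t (src a)) :=
  fun a => \matrix_(r, l) w 0 (enum_rank (Tagged (fun a =>
    ('I_(t (src a)) * 'I_(d (tgt a)) * 'I_s)%type) (l, r, c))).
have [h hh] : exists h : 'I_s -> vmap k t d, forall c a,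
    rep_point x (inl a) *m h c (src a) - h c (tgt a) *m T a = eta c a.
  apply: (fin_all_exists (P := fun c h => forall a,
    rep_point x (inl a) *m h (src a) - h (tgt a) *m T a = eta c a)) => c.
  exact: (quotient_coboundary hExt homx surj (eta c)).
(* the point with the same base representation as x and the fibre part h *)
pose Y : rep k D := fun a => match a with
  | inl b => rep_point x (inl b)
  | inr rl => \matrix_(r, c) h c (tag rl) r (tagged rl)
  end.
pose y : 'rV[k]_N := point_of Y.
have yx : y *m proj_on k base_coord = x *m proj_on k base_coord.
  apply/rowP => j; rewrite -[j]enum_valK.
  case: (enum_val j) => [[a|rl] [p q]]; rewrite !proj_onE /base_coord enum_rankK /=.
    by rewrite /y /point_of mxE enum_rankK /= mxE.
  by rewrite !mulr0.
(* off the base coordinates the system only sees y, and it is evaluated at x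
   because x and y have the same base point *)
exists (y - y *m proj_on k base_coord); split.
  by rewrite mulmxBl -mulmxA proj_on_id subrr.
rewrite mulmxBl -[_ *m proj_on _ _ *m _]mulmxA proj_on_coef mulmx0 subr0.
rewrite (coef_mx_eq linear_off_one_point_eq (esym yx)).
apply/rowP => e; rewrite -(meval_coef_mx linear_off_one_point_eq).
rewrite meval_one_point_eq -[in RHS](enum_valK e).
case: (enum_val e) => a [[l r] c].
rewrite relator_hom_comp.
have -> : rep_point y (inl a) = rep_point x (inl a) by rewrite /rep_point point_ofK.
have yh i : hom_comp (rep_point y) c i = h c i.
  by apply/matrixP => u v; rewrite mxE /rho /rep_point point_ofK mxE.
by rewrite !yh hh mxE.
Qed.

Lemma hom_partE (X : rep k D) i : hom_part X i = \mxrow_c hom_comp X c i.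
Proof. by []. Qed.

(** Surjectivity is an open condition: it persists as long as a fixed right
    inverse of [f] at one point composes with [f] to an invertible map. *)
Lemma locally_open_rep_full gamma : gamma =1 d ->
  locally_open (zeros (one_point_eqs T s d)) (rep_full T s d gamma).
Proof.
move=> hd; split=> [x []//|x [x0 rx]].
have [G hG] : exists G : forall i, 'M[k]_(_, d i),
    forall i, hom_part (rep_point x) i *m G i = 1%:M.
  apply: (fin_all_exists (P := fun i G => hom_part (rep_point x) i *m G = 1%:M)) => i.
  by apply/row_freeP; rewrite /row_free rx hd.
have [p hp] : polyfun (fun z : 'rV[k]_N =>
    \prod_i \det (hom_part (rep_point z) i *m G i)).
  apply: polyfun_prod => i _; apply: polyfun_det; apply: polymxM; last first.
    exact: polymx_const.
  by move=> r j; eexists 'X_(_) => z; rewrite mevalXU !mxE.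
exists p; first by rewrite -hp big1 ?oner_neq0 // => i _; rewrite hG det1.
move=> z z0; rewrite -hp => /prodf_neq0 dz; split=> // i.
have := dz i isT; rewrite -unitfE -unitmxE => /mxrank_unit ri.
by apply/eqP; rewrite eqn_leq hd rank_leq_row -[X in (X <= _)%N]ri mxrankM_maxl.
Qed.

Lemma rep_full_of_hom gamma (M : rep k d) (f : vmap k (pow_dim s t) d) :
  is_hom (rep_pow T s) M f -> has_rank f gamma ->
  exists x, rep_full T s d gamma x.
Proof.
move=> homf rf.
pose X : rep k D := fun a => match a with
  | inl b => M b
  | inr rl => \matrix_(r, c) submxrow (f (tag rl)) c r (tagged rl)
  end.
have Xb a : rep_point (point_of X) (inl a) = M a by rewrite /rep_point point_ofK.
have Xh c i : hom_comp (rep_point (point_of X)) c i = submxrow (f i) c.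
  by apply/matrixP => r l; rewrite mxE /rho /rep_point point_ofK mxE.
exists (point_of X); split.
  apply/zeros_one_point => c a; rewrite !Xh /base_part Xb.
  have := congr1 (fun A => submxrow A c) (homf a).
  rewrite -{1}[f (tgt a)]submxrowK -{1}[f (src a)]submxrowK.
  rewrite mul_mxrow_mxblock mul_mxrow !mxrowK => <-.
  rewrite (bigD1 c) //= eqxx big1 ?addr0 // => c' /negPf cc'.
  by rewrite cc' mulmx0.
move=> i; rewrite hom_partE -(rf i); congr (\rank _).
by rewrite -[RHS]submxrowK; apply/eq_mxrow => c; rewrite Xh.
Qed.

End OnePointEquations.

(** A set that is dense in a nonempty set is nonempty, so a general
    representation and a general homomorphism to it exist. *)
Lemma general_rank_hom (k : closedFieldType) (Q : quiver) (t : vert Q -> nat)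
    (T : rep k t) s (d gamma : vert Q -> nat) :
  is_general_rank T s d gamma ->
  exists (M : rep k d) (f : vmap k (pow_dim s t) d),
    is_hom (rep_pow T s) M f /\ has_rank f gamma.
Proof.
move=> [U [_ [_ denseU] hU]].
have empty n (X : aset k n) : closed_in X (fun _ => False).
  exists (fun p => p = 1) => x; split=> // -[_ /(_ 1 erefl)/eqP].
  by rewrite meval1 oner_eq0.
have nonempty n (X V : aset k n) x : X x -> dense_in X V -> exists y, V y.
  move=> Xx [_ dV]; apply: NNPP => V0.
  by apply: (dV _ (empty n X)) Xx => y Vy; case: V0; exists y.
have [M UM] : exists M, U M by apply: (@nonempty _ (@asetT _ _) U 0).
have [_ [W [_ denseW hW]]] := hU M UM.
have [f Wf] : exists f, W f.
  apply: (nonempty _ _ _ 0 _ denseW) => a.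
  have z i : vmap_point (0 : 'rV[k]_#|vmap_coord (pow_dim s t) d|) i = 0.
    by apply/matrixP => u v; rewrite !mxE.
  by rewrite !z mul0mx mulmx0.
exists (rep_point M), (vmap_point f); split; last exact: hW.
by apply: (denseW.1 _ Wf).
Qed.

(** * Dimension count *)

Lemma card_eq_index (Q : quiver) (t d : vert Q -> nat) s :
  #|eq_index t s d| = (s * \sum_(a : arr Q) t (src a) * d (tgt a))%N.
Proof.
rewrite card_tagged sumnE big_map big_enum /= big_distrr /=.
by apply: eq_bigr => a _; rewrite !card_prod !card_ord mulnC.
Qed.

Lemma card_ext_coord (Q : quiver) (t d : vert Q -> nat) s :
  #|rep_coord (ext_dim (t := t) s d)| =
  (#|rep_coord d| + s * \sum_i t i * d i)%N.
Proof.
rewrite !card_coord big_sumType /=; congr (_ + _)%N.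
rewrite big_distrr /=.
rewrite -(@sig_big_dep _ _ _ _ (fun i => 'I_(t i)) xpredT (fun _ => xpredT)
  (fun i _ => d i * s)%N) /=.
by apply: eq_bigr => i _; rewrite sum_nat_const card_ord mulnA mulnC.
Qed.

Theorem theorem4p8 (k : closedFieldType) (Q : quiver) (t : vert Q -> nat)
    (T : rep k t) (s : nat) (d gamma : vert Q -> nat)
    (hgamma : is_general_rank T s d gamma) (hd : gamma =1 d)
    (hExt : ext1_eq0 T T) :
  [/\ irreducible (rep_full T s d gamma),
      smooth_on (one_point_eqs T s d) (rep_full T s d gamma) &
      exists m n : nat,
        [/\ has_dim (@asetT k #|rep_coord d|) m,
            has_dim (rep_full T s d gamma) n &
            n%:Z = m%:Z + s%:Z * euler_form t d]].
Proof.
have opn := locally_open_rep_full T s hd.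
have [M [f [homf rf]]] := general_rank_hom hgamma.
have [x0 full0] := rep_full_of_hom homf rf.
have full_rank x : rep_full T s d gamma x ->
    full_rank_at (@base_coord Q t s d) (@one_point_eq k Q t T s d) x.
  by move=> [xz rx]; apply: full_rank_one_point => // i; rewrite rx hd.
have lin e := @linear_off_one_point_eq k Q t T s d e.
have eqsP := @one_point_eqsP k Q t T s d.
split.
- exact: (kernel_bundle_irreducible lin eqsP opn (ex_intro _ x0 full0)).
- move=> x xf; exact: (kernel_bundle_smooth lin eqsP (full_rank x xf) xf.1).
exists #|rep_coord d|, (#|rep_coord (ext_dim (t := t) s d)| - #|eq_index t s d|)%N.
split.
- exact: has_dim_affine.
- exact: (kernel_bundle_has_dim lin eqsP opn (ex_intro _ x0 full0)).
have rN := full_rank_le (full_rank x0 full0).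
rewrite -subzn // card_ext_coord card_eq_index.
have PoszS (I : finType) (F : I -> nat) :
    (\sum_i F i)%N%:Z = \sum_i (F i)%:Z by apply: (big_morph Posz PoszD erefl).
by rewrite PoszD !PoszM /euler_form !PoszS mulrBr addrA.
Qed.
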